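(* A minimal topological dynamical system $(X,T)$ is mildly mixing if and only if there is no nonconstant locally IP-rigid continuous function $f:X\to\mathbb R$.
   Context: $\mathbb N=\{1,2,\dots\}$. A topological dynamical system is a pair $(X,T)$ with $X$ a nonempty compact metric space and $T:X\to X$ a homeomorphism. It is minimal if every forward orbit $\{T^nx:n\ge0\}$ is dense. It is transitive if for all nonempty open $U,V\subseteq X$ there is $n\in\mathbb N$ with $U\cap T^{-n}V\neq\emptyset$. It is mildly mixing if $(X\times Y,T\times S)$ is transitive for every transitive topological dynamical system $(Y,S)$. $\mathcal F$ is the set of nonempty finite subsets of $\mathbb N$; $\eta<\alpha$ means $\max\eta<\min\alpha$. For a sequence $(p_i)_{i\ge1}\subseteq\mathbb N$ (no monotonicity or injectivity assumed), $p_\alpha=\sum_{i\in\alpha}p_i$. For real numbers $(a_\alpha)_{\alpha\in\mathcal F}$, $\operatorname{IP\text{-}lim}_{\alpha\in\mathcal F}a_\alpha=a$ means: for every $\varepsilon>0$ there is $\eta\in\mathcal F$ with $|a_\alpha-a|<\varepsilon$ for all $\alpha>\eta$. For nonempty $U\subseteq X$ and bounded $h$, $\|h\|_U=\sup_{x\in U}|h(x)|$. A continuous function $f:X\to\mathbb R$ is locally IP-rigid if, for some nonempty open $U\subseteq X$ and some sequence $(p_i)\subseteq\mathbb N$, $\operatorname{IP\text{-}lim}_{\alpha\in\mathcal F}\|f\circ T^{p_\alpha}-f\|_U=0$. *)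

(* Defs.v *)
From mathcomp Require Import all_boot all_order all_algebra.
From mathcomp Require Import finmap.
From mathcomp Require Import all_classical all_reals.
From mathcomp Require Import topology normedtype.

Set Implicit Arguments.
Unset Strict Implicit.
Unset Printing Implicit Defensive.

Import Order.TTheory GRing.Theory Num.Theory.
Import numFieldNormedType.Exports.

Local Open Scope classical_set_scope.
Local Open Scope ring_scope.

Definition homeomorphism (X Y : topologicalType) (T : X -> Y) : Prop :=
  continuous T /\
  exists S : Y -> X, [/\ cancel T S, cancel S T & continuous S].

Definition tds (R : realType) (X : metricType R) (T : X -> X) : Prop :=
  [/\ [set: X] !=set0, compact [set: X] & homeomorphism T].

Definition minimal (X : topologicalType) (T : X -> X) : Prop :=
  forall x : X, dense (range (fun n : nat => iter n T x)).

Definition top_transitive (X : topologicalType) (T : X -> X) : Prop :=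
  forall U V : set X, open U -> U !=set0 -> open V -> V !=set0 ->
  exists2 n : nat, (0 < n)%N & U `&` (iter n T @^-1` V) !=set0.

Definition prod_map (X Y : Type) (T : X -> X) (S : Y -> Y) (z : X * Y) : X * Y :=
  (T z.1, S z.2).

(* X * Y carries the product topology. *)
Definition mildly_mixing (R : realType) (X : metricType R) (T : X -> X) : Prop :=
  forall (Y : metricType R) (S : Y -> Y),
    tds S -> top_transitive S -> top_transitive (prod_map T S).

(* The nonempty finite subsets of {1, 2, ...}, as finite subsets of nat. *)
Definition finN (alpha : {fset nat}) : bool :=
  (alpha != fset0) && (0%N \notin alpha).

Definition fset_max (alpha : {fset nat}) : nat := \max_(i <- alpha) i.

(* minn has no neutral element; starting from the maximum is harmless. *)
Definition fset_min (alpha : {fset nat}) : nat :=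
  \big[minn/fset_max alpha]_(i <- alpha) i.

Definition fset_lt (eta alpha : {fset nat}) : bool :=
  (fset_max eta < fset_min alpha)%N.

(* Sequences (p_i), i >= 1, are functions p : nat -> nat whose value at 0 is
   irrelevant, since 0 belongs to no alpha with finN alpha. *)
Definition IP_sum (p : nat -> nat) (alpha : {fset nat}) : nat :=
  (\sum_(i <- alpha) p i)%N.

Definition IP_lim (R : realType) (a : {fset nat} -> R) (l : R) : Prop :=
  forall e : R, 0 < e ->
  exists2 eta : {fset nat}, finN eta &
    forall alpha : {fset nat}, finN alpha -> fset_lt eta alpha ->
      `|a alpha - l| < e.

Definition sup_norm_on (R : realType) (X : Type) (U : set X) (h : X -> R) : R :=
  sup [set `|h x| | x in U].

Definition locally_IP_rigid (R : realType) (X : metricType R) (T : X -> X)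
    (f : X -> R) : Prop :=
  exists (U : set X) (p : nat -> nat),
    [/\ open U, U !=set0, (forall i, (0 < i)%N -> (0 < p i)%N) &
      IP_lim (fun alpha =>
        sup_norm_on U (fun x => f (iter (IP_sum p alpha) T x) - f x)) 0].

Definition nonconstant (X Y : Type) (f : X -> Y) : Prop :=
  ~ exists c : Y, forall x : X, f x = c.

Lemma fset_max_leP (alpha : {fset nat}) (n : nat) :
  reflect (forall i, i \in alpha -> (i <= n)%N) (fset_max alpha <= n)%N.
Proof.
apply: (iffP idP) => [le_n i ia|le_n].
  by apply: leq_trans le_n; rewrite /fset_max; apply: leq_bigmax_seq.
by rewrite /fset_max; apply/bigmax_leqP_seq => i ia _; apply: le_n.
Qed.

Lemma fset_min_gtP (alpha : {fset nat}) (n : nat) : alpha != fset0 ->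
  reflect (forall i, i \in alpha -> (n < i)%N) (n < fset_min alpha)%N.
Proof.
move=> a0.
have minE s d : (n < \big[minn/d]_(i <- s) i)%N = (n < d)%N && all (ltn n) s.
  elim: s => [|i s IHs]; first by rewrite big_nil /= andbT.
  by rewrite big_cons leq_min IHs /= andbCA.
rewrite /fset_min minE; apply: (iffP andP) => [[_ /allP]//|lt_n].
split; last exact/allP.
have /fset0Pn[k ka] := a0.
by apply: leq_trans (lt_n _ ka) _; apply: (fset_max_leP _ _ (leqnn _)).
Qed.

Lemma fset_ltP (eta alpha : {fset nat}) : finN eta -> finN alpha ->
  reflect (forall i j, i \in eta -> j \in alpha -> (i < j)%N)
          (fset_lt eta alpha).
Proof.
move=> /andP[e0 _] /andP[a0 _]; rewrite /fset_lt.
apply: (iffP (fset_min_gtP _ a0)) => [lt_max i j ie ja|lt_ij j ja].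
  by apply: leq_ltn_trans (lt_max _ ja); apply: (fset_max_leP _ _ (leqnn _)).
have /fset0Pn[k ke] := e0.
have j0 : (0 < j)%N by apply: leq_trans (lt_ij _ _ ke ja).
rewrite -(prednK j0) ltnS; apply/fset_max_leP => i ie.
by rewrite -ltnS (prednK j0) lt_ij.
Qed.

(* Main.v *)
Require Import Defs.
From mathcomp Require Import all_boot all_order all_algebra.
From mathcomp Require Import all_classical all_reals.
From mathcomp Require Import topology normedtype.
Import numFieldNormedType.Exports.
From HB Require Import structures.
From mathcomp Require Import finmap zify lra.

Set Implicit Arguments.
Unset Strict Implicit.
Unset Printing Implicit Defensive.

Import Order.TTheory GRing.Theory Num.Theory.

Local Open Scope classical_set_scope.
Local Open Scope ring_scope.

(** Both directions go through return times along an IP set. For open sets U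
    and B write N(U,B) for the set of times n with T^n U meeting B.

    If N(U,B) misses all the sums p_alpha, and U and B are disjoint, then any
    continuous f vanishing off B but not everywhere is rigid for a trivial
    reason: f and every f o T^(p_alpha) are zero on U. Such U, B and p exist as
    soon as T is not mildly mixing. Indeed, if boxes A x C and A' x C' witness
    that T x S is not transitive, pick l > 0 such that V, the intersection of C
    and S^(-l) C', is nonempty. Transitivity of S yields p with all p_alpha in
    N(V,V) (transitive_IP_sequence); then p_alpha + l is a return time from C
    to C', hence not one from A to A', so that T^(p_alpha) A misses
    B = T^(-l) A'. The time l itself shows that A and B are disjoint.

    Conversely, if f is rigid on U along p, and x0 in U and b have different
    values under f, shrink U around x0 until f is nearly constant, and let B be
    the points whose value is far from f x0: then B is nonempty and T^(p_alpha)
    U misses B for all late alpha. The core of the proof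
    (mild_mixing_return_times) is that for a minimal mildly mixing T this
    cannot happen. Suppose it does. Inside the set of late sums p_alpha,
    together with 0, choose a set P whose indicator y, a point of {0,1}^Z, is
    recurrent under the shift sigma (recurrent_subset_of_IP_set); its orbit
    closure Y is a transitive system, so T x sigma is transitive on X x Y.
    For every i the set G_i of pairs (x,w) such that w_j = 1 and T^(i+j) x lies
    in B for some j >= 0 is open, nonempty, and contains the preimages of
    itself under T x sigma, so it is dense. By minimality there is k such that
    any k consecutive points of an orbit meet U. The intersection of G_0, ...,
    G_(k-1) is open and dense and hence contains some (x, sigma^m y).
    But some i < k has T^(i-m) x in U. For this i, every j with
    (sigma^m y)_j = 1 has j + m in P, so that T^(i+j) x = T^(j+m) (T^(i-m) x)
    is not in B, which contradicts (x, sigma^m y) being in G_i. *)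

(** * Recurrent subsets of IP sets *)

(** The set P is the set of finite sums of the q_j = block_gap j, where q_j is
    the sum of p over the j-th of a sequence of consecutive blocks of indices.
    As p >= 1, taking the blocks long makes q_j exceed q_0 + ... + q_(j-1) + j.
    Thus the elements of P within distance j of q_j are exactly q_j + m for
    the elements m <= j of P. *)
Section Blocks.
Local Open Scope nat_scope.
Variables (p : nat -> nat) (N : nat).
Hypothesis p_gt0 : forall i, 0 < i -> 0 < p i.

Fixpoint block_start (j : nat) : nat :=
  if j is j'.+1 then
    block_start j' + (\sum_(N.+1 <= i < block_start j') p i + j').+1
  else N.+1.

(** The sum of all earlier gaps, which is the largest element of P formed from
    blocks before the j-th. *)
Definition block_total (j : nat) : nat := \sum_(N.+1 <= i < block_start j) p i.

Definition block_gap (j : nat) : nat :=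
  \sum_(block_start j <= i < block_start j.+1) p i.

(** The elements of P that use the blocks before the j-th only. *)
Fixpoint block_sum (j m : nat) : bool :=
  if j is j'.+1 then
    block_sum j' m || (block_gap j' <= m) && block_sum j' (m - block_gap j')
  else m == 0.

Lemma block_start_le j : block_start j <= block_start j.+1.
Proof. by rewrite /= leq_addr. Qed.

Lemma block_start_gtN j : N < block_start j.
Proof. by elim: j => [//|j IH]; apply: leq_trans (block_start_le j). Qed.

Lemma block_totalS j : block_total j.+1 = block_total j + block_gap j.
Proof.
rewrite /block_total /block_gap (big_cat_nat _ (n := block_start j)) //=.
  exact: block_start_gtN.
exact: block_start_le.
Qed.

Lemma block_gap_gt j : block_total j + j < block_gap j.
Proof.
have -> : (block_total j + j).+1 =
    \sum_(block_start j <= i < block_start j.+1) 1.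
  by rewrite sum_nat_const_nat muln1 /= addKn.
rewrite /block_gap big_nat [leqRHS]big_nat; apply: leq_sum => i /andP[ji _].
by rewrite p_gt0 //; have := block_start_gtN j; lia.
Qed.

Lemma block_sum_le j m : block_sum j m -> m <= block_total j.
Proof.
elim: j m => [|j IH] m /=; first by move/eqP->.
rewrite block_totalS => /orP[/IH|/andP[_ /IH]]; lia.
Qed.

Lemma block_sum_leq j k m : j <= k -> block_sum j m -> block_sum k m.
Proof.
move=> /subnKC <-; elim: (k - j) => [|d IH]; first by rewrite addn0.
by rewrite addnS /= => /IH ->.
Qed.

(** A sum that uses the block j or a later one is at least q_j, because the
    gaps increase. *)
Lemma block_sum_small j k m : m < block_gap j -> block_sum k m -> block_sum j m.
Proof.
move=> mj; elim: k => [|k IH]; first by apply: block_sum_leq.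
have [kj|jk] := ltnP k j; first exact: block_sum_leq.
rewrite /= => /orP[//|/andP[km _]].
suff : block_gap j <= block_gap k by lia.
elim: {IH km} k jk => [|k IH]; first by rewrite leqn0 => /eqP->.
rewrite leq_eqVlt => /predU1P[->//|/IH].
by have := block_gap_gt k.+1; rewrite block_totalS; lia.
Qed.

Lemma block_sum_IP_sum j m : block_sum j m ->
  exists2 alpha : {fset nat},
    forall i, i \in alpha -> N < i < block_start j & m = IP_sum p alpha.
Proof.
elim: j m => [|j IH] m /=.
  by move/eqP->; exists fset0 => //; rewrite /IP_sum big_seq_fset0.
rewrite -/(block_start j.+1); move: (block_start_le j) => bj.
move=> /orP[/IH[a aj ->]|/andP[jm /IH[a aj ma]]].
  by exists a => // i /aj; lia.
pose b := [fset i in index_iota (block_start j) (block_start j.+1)]%fset.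
exists (a `|` b)%fset => [i|].
  rewrite !inE mem_index_iota => /orP[/aj|]; first lia.
  by have := block_start_gtN j; lia.
have -> : IP_sum p (a `|` b)%fset =
    \sum_(i <- enum_fset a ++
               index_iota (block_start j) (block_start j.+1)) p i.
  apply: perm_big; apply: uniq_perm => [||i]; first exact: fset_uniq.
    rewrite cat_uniq fset_uniq iota_uniq andbT /=.
    by apply/hasPn => i; rewrite mem_index_iota => ji; apply/negP => /aj; lia.
  by rewrite mem_cat !inE.
by rewrite big_cat -/(IP_sum p a) -ma -/(block_gap j); apply/esym/subnK.
Qed.

(** The last clause is two-sided recurrence of the indicator of P on the
    integers: near m = q_l the set P looks as it does near 0, so in particular
    it has nothing just below m. An IP set itself need not be recurrent in this
    sense, hence the passage to a sparse P. *)
Lemma recurrent_subset_of_IP_set : exists P : nat -> Prop,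
  [/\ P 0,
      forall m, P m -> exists2 alpha : {fset nat},
        (forall i, i \in alpha -> N < i) & m = IP_sum p alpha &
      forall l, exists2 m, l < m &
        forall i, i <= l -> (P (m + i) <-> P i) /\ (0 < i -> ~ P (m - i))].
Proof.
exists (fun m => exists j, block_sum j m); split.
- by exists 0.
- by move=> m [j /block_sum_IP_sum[a aj ->]]; exists a => // i /aj /andP[].
move=> l; have gapl := block_gap_gt l; exists (block_gap l) => [|i il].
  by apply: leq_ltn_trans gapl; rewrite leq_addl.
split; last first.
  move=> i0 [k Pk]; have /block_sum_le : block_sum l (block_gap l - i).
    by apply: block_sum_small Pk; lia.
  lia.
split=> [[k Pk]|[k Pk]].
  have : block_sum l.+1 (block_gap l + i).
    apply: block_sum_small Pk.
    by have := block_gap_gt l.+1; rewrite block_totalS; lia.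
  move=> /= /orP[/block_sum_le|]; first by lia.
  by rewrite addKn => /andP[_ H]; exists l.
exists l.+1; rewrite /= addKn leq_addr /= (block_sum_small _ Pk) ?orbT //; lia.
Qed.

End Blocks.

(** * Bi-infinite binary sequences as a metric space *)

Definition agree (l : nat) (v w : int -> bool) : bool :=
  `[< forall j : int, - l%:Z <= j <= l%:Z -> v j = w j >].

Lemma agreeP l v w :
  reflect (forall j : int, - l%:Z <= j <= l%:Z -> v j = w j) (agree l v w).
Proof. exact: asboolP. Qed.

Lemma agreexx l v : agree l v v.
Proof. exact/agreeP. Qed.

Lemma agree_sym l v w : agree l v w = agree l w v.
Proof. by apply/agreeP/agreeP => H j /H ->. Qed.

Lemma agree_trans l v u w : agree l v u -> agree l u w -> agree l v w.
Proof. by move=> /agreeP H /agreeP K; apply/agreeP => j jl; rewrite H ?K. Qed.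

Lemma agree_leq k l v w : (k <= l)%N -> agree l v w -> agree k v w.
Proof. by move=> kl /agreeP H; apply/agreeP => j jk; apply: H; lia. Qed.

Lemma agree_eq v w : (forall l, agree l v w) -> v = w.
Proof.
by move=> H; apply/funext => j; have /agreeP := H `|j|%N; apply; lia.
Qed.

Definition shift (m : int) (w : int -> bool) (j : int) : bool := w (j + m).

Lemma agree_shift l (m : int) v w :
  agree (l + `|m|%N) v w -> agree l (shift m v) (shift m w).
Proof. by move=> /agreeP H; apply/agreeP => j jl; apply: H; lia. Qed.

Lemma shiftD m n w : shift m (shift n w) = shift (m + n) w.
Proof. by apply/funext => j; rewrite /shift addrA. Qed.

Lemma shift0 w : shift 0 w = w.
Proof. by apply/funext => j; rewrite /shift addr0. Qed.

Section CantorDistance.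
Variable R : realType.

(** An ultrametric with values 1 / (n + 1), where n is the radius of the
    smallest window around 0 on which the two sequences differ. *)
Definition cantor_dist (v w : int -> bool) : R :=
  if pselect (exists l, ~~ agree l v w) is left h then (ex_minn h).+1%:R^-1
  else 0.

Lemma cantor_dist_lt l v w : (cantor_dist v w < l.+1%:R^-1) = agree l v w.
Proof.
rewrite /cantor_dist; case: pselect => [h|h]; last first.
  by rewrite invr_gt0 ltr0n; apply/esym/negPn/negP => H; apply: h; exists l.
case: ex_minnP => n Hn minn.
rewrite ltf_pV2 ?posrE ?ltr0n // ltr_nat ltnS.
apply/idP/idP => [ln|H]; first by apply/negPn/negP => /minn; lia.
by rewrite ltnNge; apply/negP => nl; case/negP: Hn; apply: agree_leq H.
Qed.

Lemma cantor_dist_cases v w :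
  cantor_dist v w = 0 \/
  exists2 n, ~~ agree n v w & cantor_dist v w = n.+1%:R^-1.
Proof.
rewrite /cantor_dist; case: pselect => [h|h]; last by left.
by right; case: ex_minnP => n Hn _; exists n.
Qed.

Lemma cantor_dist_ge0 v w : 0 <= cantor_dist v w.
Proof.
by have [->|[n _ ->]] := cantor_dist_cases v w; rewrite ?invr_ge0 ?ler0n.
Qed.

Lemma cantor_distxx v : cantor_dist v v = 0.
Proof. by have [//|[n]] := cantor_dist_cases v v; rewrite agreexx. Qed.

Lemma cantor_dist_eq0 v w : cantor_dist v w = 0 -> v = w.
Proof.
by move=> d0; apply: agree_eq => l; rewrite -cantor_dist_lt d0 invr_gt0 ltr0n.
Qed.

Lemma cantor_dist_sym v w : cantor_dist v w = cantor_dist w v.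
Proof.
have le u t : cantor_dist u t <= cantor_dist t u.
  have [->|[n Hn ->]] := cantor_dist_cases u t; first exact: cantor_dist_ge0.
  by rewrite leNgt cantor_dist_lt agree_sym.
by apply/eqP; rewrite eq_le !le.
Qed.

Lemma cantor_dist_triangle u v w :
  cantor_dist v w <= cantor_dist v u + cantor_dist u w.
Proof.
have [->|[n Hn ->]] := cantor_dist_cases v w.
  by rewrite addr_ge0 ?cantor_dist_ge0.
have [vu|vu] := boolP (agree n v u); last first.
  by rewrite ler_wpDr ?cantor_dist_ge0 // leNgt cantor_dist_lt.
have [uw|uw] := boolP (agree n u w); first by rewrite (agree_trans vu uw) in Hn.
by rewrite ler_wpDl ?cantor_dist_ge0 // leNgt cantor_dist_lt.
Qed.

End CantorDistance.

(** * The orbit closure of a sequence under the shift *)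

Definition in_orbit_closure (y w : int -> bool) : bool :=
  `[< forall l, exists m : int, agree l w (shift m y) >].

(** The parameter R only fixes the field in which distances are measured. *)
Definition orbit_closure (R : realType) (y : int -> bool) : Type :=
  {w : int -> bool | in_orbit_closure y w}.

Section OrbitClosure.
Variables (R : realType) (y : int -> bool).
Notation Y := (orbit_closure R y).

HB.instance Definition _ := gen_eqMixin Y.
HB.instance Definition _ := gen_choiceMixin Y.

Let dist (v w : Y) : R := cantor_dist R (sval v) (sval w).

Let dist_eq0 v w : dist v w = 0 -> v = w.
Proof. by move/cantor_dist_eq0 => /val_inj. Qed.

HB.instance Definition _ := isMetric.Build R Y
  (fun v => cantor_distxx R (sval v)) dist_eq0
  (fun v w => cantor_dist_sym R (sval v) (sval w))
  (fun u v w => cantor_dist_triangle R (sval u) (sval v) (sval w)).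

Lemma nbhs_agree (w : Y) l : nbhs w [set v : Y | agree l (sval w) (sval v)].
Proof.
have := @nbhsx_ballx R Y w l.+1%:R^-1; rewrite invr_gt0 ltr0n => /(_ isT).
apply: filterS => v.
by rewrite ballEmdist /= -(cantor_dist_lt R).
Qed.

Lemma nbhs_agreeP (w : Y) (A : set Y) : nbhs w A ->
  exists l, forall v : Y, agree l (sval w) (sval v) -> A v.
Proof.
move/nbhs_ballP => [e /= e0 eA].
have [l le] : exists l : nat, l.+1%:R^-1 < e.
  exists (Num.truncn e^-1).
  by rewrite invf_plt ?posrE //; apply: truncnS_gt.
exists l => v H; apply: eA; rewrite ballEmdist /=.
by apply: lt_trans le; rewrite /mdist /= /dist cantor_dist_lt.
Qed.

End OrbitClosure.

Section OrbitClosureDynamics.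
Variables (R : realType) (y : int -> bool).
Notation Y := (orbit_closure R y).

Lemma orbit_in_closure m : in_orbit_closure y (shift m y).
Proof. by apply/asboolP => l; exists m; apply: agreexx. Qed.

Definition orbit_point (m : int) : Y := Sub (shift m y) (orbit_in_closure m).

Lemma shift_in_closure m w :
  in_orbit_closure y w -> in_orbit_closure y (shift m w).
Proof.
move=> /asboolP H; apply/asboolP => l; have [n wn] := H (l + `|m|)%N.
by exists (m + n); rewrite -shiftD; apply: agree_shift.
Qed.

(** The inverse of the homeomorphism shiftY 1 is shiftY (-1), hence the integer
    parameter. *)
Definition shiftY (m : int) (w : Y) : Y :=
  Sub (shift m (val w)) (shift_in_closure m (valP w)).

Lemma orbit_point_dense (A : set Y) : open A -> A !=set0 ->
  exists l m, forall v : Y, agree l (shift m y) (val v) -> A v.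
Proof.
move=> oA [w Aw]; have [l wl] := nbhs_agreeP (open_nbhs_nbhs (conj oA Aw)).
have /asboolP /(_ l) [m wm] := valP w.
by exists l, m => v mv; apply: wl; apply: agree_trans mv.
Qed.

Lemma shiftY_continuous m : continuous (shiftY m).
Proof.
move=> w A /nbhs_agreeP[l lA]; have := nbhs_agree w (l + `|m|)%N.
by apply: filterS => v /agree_shift wv; apply: (lA (shiftY m v)).
Qed.

Lemma shiftY_homeomorphism : homeomorphism (shiftY 1).
Proof.
split; first exact: shiftY_continuous.
exists (shiftY (-1)); split => [w|w|]; last exact: shiftY_continuous.
- by apply: val_inj; rewrite /= shiftD addrC subrr shift0.
- by apply: val_inj; rewrite /= shiftD subrr shift0.
Qed.

(** An ultrafilter converges to the sequence w for which every set of points v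
    with v_j = w_j belongs to it. *)
Lemma orbit_closure_compact : compact [set: Y].
Proof.
rewrite compact_ultra => F FU _.
pose w (j : int) := `[< F [set v : Y | val v j] >].
have Fw l : F [set v : Y | agree l w (val v)].
  have Fj j : F [set v : Y | w j = val v j].
    have [Fj|Fj] := in_ultra_setVsetC [set v : Y | val v j] FU.
      have wj : w j by apply/asboolP.
      by apply: filterS Fj => v /= vj; rewrite wj vj.
    have wj : w j = false.
      by apply/asboolP => H; have [v []] := filter_ex (filterI H Fj).
    by apply: filterS Fj => v /= /negP/negbTE ->.
  elim: l => [|l IH].
    apply: filterS (Fj 0) => v /= w0; apply/agreeP => j j0.
    by have -> : j = 0 by lia.
  apply: filterS (filterI IH (filterI (Fj l.+1%:Z) (Fj (- l.+1%:Z)))).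
  move=> v /= [/agreeP H [w1 w2]]; apply/agreeP => j jl.
  have [->//|j1] := eqVneq j l.+1%:Z.
  have [->//|j2] := eqVneq j (- l.+1%:Z).
  by apply: H; lia.
have wY : in_orbit_closure y w.
  apply/asboolP => l; have [v /= wv] := filter_ex (Fw l).
  have /asboolP /(_ l) [m vm] := valP v.
  by exists m; apply: agree_trans vm.
exists (Sub w wY : Y); split => // A /nbhs_agreeP[l lA].
by apply: filterS (Fw l) => v; apply: lA.
Qed.

Lemma orbit_closure_tds : tds (shiftY 1).
Proof.
split; [by exists (orbit_point 0) | exact: orbit_closure_compact |].
exact: shiftY_homeomorphism.
Qed.

Lemma iter_shiftY n w : val (iter n (shiftY 1) w) = shift n%:Z (val w).
Proof.
elim: n => [|n IH] /=; first by rewrite shift0.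
by rewrite IH shiftD.
Qed.

(** To go from near sigma^a y to near sigma^b y in positive time, apply
    sigma^(b - a) after a recurrence time m of y so large that b + m - a > 0. *)
Lemma orbit_closure_transitive :
  (forall l, exists2 m : nat, (l < m)%N & agree l y (shift m%:Z y)) ->
  top_transitive (shiftY 1).
Proof.
move=> rec A B oA A0 oB B0.
have [k [a aA]] := orbit_point_dense oA A0.
have [l [b bB]] := orbit_point_dense oB B0.
have [m ltm ym] := rec (l + `|a|%N + `|b|%N)%N.
have [n nE] : exists n : nat, n%:Z = b + m%:Z - a.
  by exists `|(b + m%:Z - a)%R|%N; lia.
exists n; first by lia.
exists (orbit_point a); split; first by apply: aA; apply: agreexx.
apply: bB; rewrite iter_shiftY nE /= shiftD.
have -> : b + m%:Z - a + a = b + m%:Z by lia.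
rewrite -shiftD; apply: agree_shift; apply: agree_leq ym; lia.
Qed.

End OrbitClosureDynamics.

(** * Iterates, minimality and products *)

Lemma continuous_iter (X : topologicalType) (T : X -> X) n :
  continuous T -> continuous (iter n T).
Proof.
move=> cT; elim: n => [|n IH] x; first exact: cvg_id.
by apply: continuous_comp; [exact: IH | exact: cT].
Qed.

Lemma open_preimage_iter (X : topologicalType) (T : X -> X) n (A : set X) :
  continuous T -> open A -> open (iter n T @^-1` A).
Proof.
by move=> cT oA; apply: open_comp oA => x _; apply: continuous_iter.
Qed.

Lemma iter_cancel (X : Type) (T S : X -> X) n :
  cancel S T -> cancel (iter n S) (iter n T).
Proof. by move=> ST; elim: n => [//|n IH] x; rewrite iterSr /= ST IH. Qed.

(** If no k worked, a cluster point of the sets of points whose first k iterates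
    avoid U would have an orbit that never enters U. *)
Lemma minimal_cover (X : topologicalType) (T : X -> X) (U : set X) :
  compact [set: X] -> continuous T -> minimal T -> open U -> U !=set0 ->
  exists k, forall x, exists2 i, (i < k)%N & U (iter i T x).
Proof.
move=> cX cT mT oU U0.
apply: contrapT => nocover.
pose miss k := [set x | forall i, (i < k)%N -> ~ U (iter i T x)].
have miss0 k : miss k !=set0.
  apply: contrapT => /set0P/negP/negPn/eqP m0; apply: nocover; exists k => x.
  apply: contrapT => noi; suff : miss k x by rewrite m0.
  by move=> i ik Ux; apply: noi; exists i.
have FF : ProperFilter (filter_from setT miss).
  apply: filter_from_proper => [|k _]; last exact: miss0.
  apply: filter_from_filter => [|k l _ _]; first by exists 0%N.
  exists (maxn k l) => // x mx.
  by split=> i il; apply: mx; rewrite leq_max il ?orbT.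
have [|x [_ clx]] := cX _ FF; first by exists 0%N.
have [t [Ut [i _ xi]]] := mT x U U0 oU.
have [||z [mz]] := clx (miss i.+1) (iter i T @^-1` U); last exact: mz.
  by exists i.+1.
by apply: open_nbhs_nbhs; split; [exact: open_preimage_iter | rewrite /= xi].
Qed.

Lemma iter_prod_map (X Y : Type) (T : X -> X) (S : Y -> Y) n z :
  iter n (prod_map T S) z = (iter n T z.1, iter n S z.2).
Proof. by elim: n => [|n /= ->]; case: z. Qed.

Lemma open_box (X Y : topologicalType) (O : set (X * Y)) :
  open O -> O !=set0 ->
  exists (A : set X) (B : set Y),
    [/\ open A, A !=set0, open B, B !=set0 & A `*` B `<=` O].
Proof.
move=> oO [[a b] Oab].
have [[P Q] [/= Pa Qb] PQ] := open_nbhs_nbhs (conj oO Oab).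
exists P°, Q°; split; try exact: open_interior; [by exists a | by exists b|].
by move=> [u v] [/= /interior_subset Pu /interior_subset Qv]; apply: PQ.
Qed.

(** * Return times of minimal mildly mixing systems *)

Lemma recurrent_bi_infinite (p : nat -> nat) (N : nat) :
  (forall i, (0 < i)%N -> (0 < p i)%N) ->
  exists y : int -> bool,
    [/\ y 0,
        forall j, y j -> exists2 alpha : {fset nat},
          (forall i, i \in alpha -> (N < i)%N) & j = (IP_sum p alpha)%:Z &
        forall l, exists2 m : nat, (l < m)%N & agree l y (shift m%:Z y)].
Proof.
move=> /(recurrent_subset_of_IP_set N)[P [P0 PIP Prec]].
pose y (j : int) := if j is Posz n then `[< P n >] else false.
exists y; split; first exact/asboolP.
  by case=> [n /asboolP/PIP[a aN ->]|//]; exists a.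
move=> l; have [m lm mP] := Prec l; exists m => //.
apply/agreeP => -[i|i] il; rewrite /shift.
  have /mP[H _] : (i <= l)%N by lia.
  by rewrite /y addrC -PoszD; apply: asbool_equiv_eq; rewrite H.
have -> : Negz i + m%:Z = (m - i.+1)%:Z by lia.
have /mP[_ H] : (i.+1 <= l)%N by lia.
by rewrite /y; apply/esym/asboolPn; apply: H.
Qed.

(** Mild mixing directly controls only differences of two sums p_alpha; it is
    minimality that brings this down to the sums themselves. Indices are
    required to exceed N so that the conclusion applies to every tail of the IP
    set. The set alpha may be empty because 0 has to belong to P. *)
Lemma mild_mixing_return_times (R : realType) (X : metricType R) (T : X -> X)
    (U B : set X) (p : nat -> nat) (N : nat) :
  tds T -> minimal T -> mildly_mixing T ->
  open U -> U !=set0 -> open B -> B !=set0 ->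
  (forall i, (0 < i)%N -> (0 < p i)%N) ->
  exists2 alpha : {fset nat}, forall i, i \in alpha -> (N < i)%N &
    U `&` (iter (IP_sum p alpha) T @^-1` B) !=set0.
Proof.
move=> [_ cX [cT [T' [TK T'K cT']]]] mT mixT oU U0 oB B0 p0.
have [y [y0 yIP yrec]] := recurrent_bi_infinite N p0.
have := mixT _ _ (orbit_closure_tds R y) (orbit_closure_transitive yrec).
set S := shiftY 1 => transTS.
have [k kU] := minimal_cover cX cT mT oU U0.
pose G i (z : X * orbit_closure R y) :=
  exists j : nat, val z.2 j%:Z /\ B (iter (i + j) T z.1).
have openG i : open (G i).
  rewrite openE => -[x w] [j [/= wj Bx]].
  exists (iter (i + j) T @^-1` B, [set v | agree j (val w) (val v)]).
    split; last exact: nbhs_agree.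
    by apply: open_nbhs_nbhs; split => //; apply: open_preimage_iter.
  move=> [u v] /= [Bu /agreeP wv]; exists j; split => //=.
  by rewrite -wv //; lia.
have G0 i : G i !=set0.
  have [b Bb] := B0; exists (iter i T' b, orbit_point R y 0), 0%N.
  by split; rewrite /= ?addn0 ?iter_cancel.
have invG i n z : G i (iter n (prod_map T S) z) -> G i z.
  rewrite iter_prod_map => -[j [/=]]; rewrite iter_shiftY => wj.
  rewrite -iterD => Bx; exists (j + n)%N; split => //.
  by rewrite addnA.
(* A nonempty open O inside G_0, ..., G_(k-1): a transition time from O to the
   next G_i produces a point of O in G_i itself, by invG. *)
have [O [oO O0 OG]] : exists O : set (X * orbit_closure R y),
    [/\ open O, O !=set0 & forall i, (i < k)%N -> O `<=` G i].
  elim: {kU} k => [|k [O [oO O0 OG]]].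
    exists setT; split; [exact: openT | | by []].
    by have [z _] := G0 0; exists z.
  exists (O `&` G k); split; first exact: openI.
    have [n _ [z [Oz Gz]]] := transTS O (G k) oO O0 (openG k) (G0 k).
    by exists z; split => //; apply: invG Gz.
  move=> i; rewrite ltnS leq_eqVlt => /predU1P[->|ik] z [Oz Gz] //.
  exact: OG Oz.
have [A [C [oA [x Ax] oC C0 ACO]]] := open_box oO O0.
have [l [m mC]] := orbit_point_dense oC C0.
have Gx i : (i < k)%N -> exists j : nat, y (j%:Z + m) /\ B (iter (i + j) T x).
  move=> ik; have := OG i ik (x, orbit_point R y m); apply.
  by apply: ACO; split => //=; apply: mC; apply: agreexx.
(* x' stands for T^(-m) x; the integer m may have either sign. *)
have [x' Hx'] : exists x', forall i j n : nat, n%:Z = j%:Z + m ->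
    iter (i + j) T x = iter n T (iter i T x').
  have [n nm] : exists n : nat, m = n%:Z \/ m = - n%:Z.
    by exists `|m|%N; lia.
  case: nm => ->.
    exists (iter n T' x) => i j q qE.
    rewrite -iterD; have -> : (q + i = (i + j) + n)%N by lia.
    by rewrite [RHS]iterD (iter_cancel n T'K).
  exists (iter n T x) => i j q qE; rewrite -!iterD; congr (iter _ T x); lia.
have [i ik Ux'] := kU x'.
have [j [yj Bx]] := Gx i ik.
have [alpha aN jm] := yIP _ yj.
exists alpha => //; exists (iter i T x'); split => //=.
by rewrite -(Hx' i j).
Qed.

(** * Mild mixing excludes rigid functions *)

Lemma continuous_norm_bounded (R : realType) (X : topologicalType)
    (f : X -> R) :
  compact [set: X] -> continuous f -> exists M : R, forall x, `|f x| <= M.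
Proof.
move=> cX cf.
have : compact (f @` setT).
  by apply: continuous_compact => //; exact: continuous_subspaceT.
move=> /compact_bounded[M [_ MB]]; exists (M + 1) => x.
by apply: (MB (M + 1)); [rewrite ltrDl | exists x].
Qed.

Lemma mild_mixing_no_rigid (R : realType) (X : metricType R) (T : X -> X)
    (f : X -> R) :
  tds T -> minimal T -> mildly_mixing T ->
  continuous f -> nonconstant f -> ~ locally_IP_rigid T f.
Proof.
move=> tdsT mT mixT cf ncf [U [p [oU [x0 Ux0] p0 lim]]].
have [_ cX [cT _]] := tdsT.
have [b fb] : exists b, f b != f x0.
  apply: contrapT => H; apply: ncf; exists (f x0) => x.
  by apply/eqP/negPn/negP => ?; apply: H; exists x.
(* On U' and along p the values of f stay within 2 e of f x0, whereas f b is at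
   distance 3 e. *)
pose e := `|f b - f x0| / 3.
have e0 : 0 < e by rewrite divr_gt0 // normr_gt0 subr_eq0.
have [eta _ rig] := lim e e0.
pose U' := U `&` [set x | `|f x - f x0| < e].
pose B := [set x | 2 * e < `|f x - f x0|].
have cg : continuous (fun x => `|f x - f x0|).
  move=> x; apply: (@continuous_comp _ _ _ (fun x => f x - f x0) Num.norm).
    by apply: continuousB; [exact: cf | exact: cst_continuous].
  exact: norm_continuous.
have oU' : open U'.
  apply: openI => //.
  apply: (@open_comp _ _ _ [set r | r < e]) => [x _|]; first exact: cg.
  exact: open_lt.
have oB : open B.
  apply: (@open_comp _ _ _ [set r | 2 * e < r]) => [x _|]; first exact: cg.
  exact: open_gt.
have U'0 : U' !=set0 by exists x0; split => //=; rewrite subrr normr0.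
have B0 : B !=set0.
  exists b; rewrite /B /= /e; move: e0; rewrite /e; lra.
have [alpha aN [x [[Ux xe] Bx]]] :=
  mild_mixing_return_times (fset_max eta) tdsT mT mixT oU' U'0 oB B0 p0.
have [a0|a0] := eqVneq alpha fset0.
  move: Bx; rewrite a0 /IP_sum big_seq_fset0 /B /=; move: xe => /=; lra.
have fina : finN alpha.
  by rewrite /finN a0; apply/negP => /aN.
have lta : fset_lt eta alpha by apply/fset_min_gtP.
(* The supremum bounds the values only once it is known to be finite. *)
have [M fM] := continuous_norm_bounded cX cf.
have : `|f (iter (IP_sum p alpha) T x) - f x| < e.
  apply: le_lt_trans (rig alpha fina lta).
  rewrite subr0; apply: le_trans (ler_norm _).
  apply: ub_le_sup; last by exists x.
  exists (M + M) => _ [z _ <-].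
  by apply: le_trans (ler_normB _ _) _; apply: lerD.
move: Bx xe; rewrite /B /=; set fy := f (iter _ _ _) => By xe yx.
have := ler_normD (fy - f x) (f x - f x0); rewrite addrA subrK.
lra.
Qed.

(** * Failure of mild mixing produces a rigid function *)

(** Choose nonempty open sets A_0 = V and A_(k+1), the intersection of A_k and
    S^(-p_k) A_k, where p_k is a return time of A_k to itself. For x in A_k,
    applying S^(p_i) for the i in alpha in decreasing order goes down the sets
    A_i and ends in V. *)
Lemma transitive_IP_sequence (Y : topologicalType) (S : Y -> Y) (V : set Y) :
  continuous S -> top_transitive S -> open V -> V !=set0 ->
  exists2 p : nat -> nat, forall i, (0 < p i)%N &
    forall alpha : {fset nat}, V `&` (iter (IP_sum p alpha) S @^-1` V) !=set0.
Proof.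
move=> cS trS oV V0.
pose W := {A : set Y | open A /\ A !=set0}.
have step (A : W) : exists n : nat,
    (0 < n)%N /\ sval A `&` (iter n S @^-1` sval A) !=set0.
  case: A => A [oA A0] /=.
  by have [n n0 H] := trS A A oA A0 oA A0; exists n.
pose q A := sval (cid (step A)).
have nextP (A : W) : open (sval A `&` (iter (q A) S @^-1` sval A)) /\
    sval A `&` (iter (q A) S @^-1` sval A) !=set0.
  rewrite /q; case: cid => n /= [_ H]; split => //.
  by apply: openI; [|apply: open_preimage_iter => //]; case: (svalP A).
pose next (A : W) : W := exist _ _ (nextP A).
pose A (k : nat) : W := iter k next (exist _ V (conj oV V0)).
pose p k := q (A k).
have Anext k : sval (A k.+1) = sval (A k) `&` (iter (p k) S @^-1` sval (A k)).
  by [].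
have p0 i : (0 < p i)%N by rewrite /p /q; case: cid => n [].
exists p => // alpha.
have ret k : forall (beta : {fset nat}) x,
    (forall i, i \in beta -> (i < k)%N) -> sval (A k) x ->
    V (iter (IP_sum p beta) S x).
  elim: k => [|k IH] beta x bk.
    have -> : beta = fset0.
      by apply/fsetP => i; rewrite in_fset0; apply/negP => /bk.
    by rewrite /IP_sum big_seq_fset0.
  rewrite Anext => -[Ax Apx].
  have [kb|kb] := boolP (k \in beta); last first.
    apply: IH Ax => i ib; have := bk i ib; rewrite ltnS leq_eqVlt.
    by move=> /predU1P[ik|//]; rewrite -ik ib in kb.
  rewrite /IP_sum (big_fsetD1 k kb) /= addnC iterD; apply: IH Apx => i.
  by rewrite !inE => /andP[ik /bk]; rewrite ltnS leq_eqVlt (negbTE ik).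
have [x Ax] := (svalP (A (fset_max alpha).+1)).2.
exists x; split.
  have := @ret _ fset0 x _ Ax; rewrite /IP_sum big_seq_fset0.
  by apply=> i; rewrite inE.
by apply: ret Ax => i ia; rewrite ltnS; apply: (fset_max_leP _ _ (leqnn _)).
Qed.

Lemma bump_function (R : realType) (X : metricType R) (B : set X) (b : X) :
  open B -> B b -> exists f : X -> R,
    [/\ continuous f, 0 < f b & forall x, ~ B x -> f x = 0].
Proof.
move=> oB Bb; have /nbhs_ballP[e /= e0 eB] := open_nbhs_nbhs (conj oB Bb).
exists (fun x => Num.max 0 (e - mdist b x)); split.
- move=> x; apply: (@continuous_max R X (cst 0) (fun z => e - mdist b z)).
    exact: cst_continuous.
  apply: continuousB; first exact: cst_continuous.
  apply/(@cvgrPdist_lt _ R^o) => d d0.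
  have := @nbhsx_ballx R X x d d0; apply: filterS => z; rewrite ballEmdist /=.
  apply: le_lt_trans; rewrite ler_distl.
  have := metric_triangle b x z; have := metric_triangle b z x.
  by rewrite (metric_sym z x); lra.
- by rewrite mdistxx subr0 lt_max e0 orbT.
move=> x Bx; apply/max_idPl; rewrite subr_le0 leNgt; apply/negP => bx.
by apply: Bx; apply: eB; rewrite ballEmdist.
Qed.

(** The function exhibited vanishes on A and on all its translates by p_alpha,
    so the supremum norms in the definition of rigidity are all 0. The points
    T^n x with x in A are kept out of A' for every return time n > 0 from C to
    C'; here n is p_alpha + l. *)
Lemma no_rigid_mild_mixing (R : realType) (X : metricType R) (T : X -> X) :
  tds T ->
  (forall f : X -> R,
      continuous f -> nonconstant f -> ~ locally_IP_rigid T f) ->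
  mildly_mixing T.
Proof.
move=> [_ _ [cT [T' [TK T'K _]]]] norigid Y S [_ _ [cS _]] trS.
move=> O O' oO O0 oO' O'0; apply: contrapT => noreturn.
have [A [C [oA A0 oC C0 ACO]]] := open_box oO O0.
have [A' [C' [oA' [a' Aa'] oC' C'0 ACO']]] := open_box oO' O'0.
have disj n : (0 < n)%N -> C `&` (iter n S @^-1` C') !=set0 ->
    forall x, A x -> ~ A' (iter n T x).
  move=> n0 [c [Cc C'c]] x Ax A'x; apply: noreturn; exists n => //.
  exists (x, c); split; first by apply: ACO.
  by rewrite /= iter_prod_map; apply: ACO'.
have [l l0 Cl] := trS C C' oC C0 oC' C'0.
pose V := C `&` (iter l S @^-1` C').
have oV : open V by apply: openI => //; exact: open_preimage_iter.
have [p p0 pV] := transitive_IP_sequence cS trS oV Cl.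
pose B := iter l T @^-1` A'.
have oB : open B by exact: open_preimage_iter.
have AB alpha x : A x -> ~ B (iter (IP_sum p alpha) T x).
  rewrite /B /= -iterD; apply: disj; first by rewrite addn_gt0 l0.
  have [c [[Cc _] [_ Cpc]]] := pV alpha.
  by exists c; split => //; rewrite /= iterD.
have AB0 x : A x -> ~ B x.
  by have := @AB fset0 x; rewrite /IP_sum big_seq_fset0.
have Bb : B (iter l T' a') by rewrite /B /= iter_cancel.
have [f [cf fb fB]] := bump_function oB Bb.
apply: (norigid f cf).
  have [a Aa] := A0; case=> c fc; move: fb.
  by rewrite fc -(fc a) fB ?ltxx //; exact: AB0.
exists A, p; split => // e e0; exists [fset 1%N]%fset.
  by rewrite /finN -cardfs_gt0 cardfs1 inE.
move=> alpha _ _; rewrite subr0.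
have -> : sup_norm_on A (fun x => f (iter (IP_sum p alpha) T x) - f x) = 0.
  rewrite /sup_norm_on -[RHS]sup1; congr sup.
  apply/seteqP; split => [_ [x Ax <-]|_ ->].
    by rewrite (fB _ (AB _ _ Ax)) (fB _ (AB0 _ Ax)) subrr normr0.
  have [a Aa] := A0; exists a => //.
  by rewrite (fB _ (AB _ _ Aa)) (fB _ (AB0 _ Aa)) subrr normr0.
by rewrite normr0.
Qed.

Theorem theorem3 (R : realType) (X : metricType R) (T : X -> X)
    (X_tds : tds T) (T_min : minimal T) :
  mildly_mixing T <->
  ~ exists f : X -> R,
      [/\ continuous f, nonconstant f & locally_IP_rigid T f].
Proof.
split=> [mixT [f [cf ncf rigf]]|norigid].
  exact: mild_mixing_no_rigid X_tds T_min mixT cf ncf rigf.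
apply: no_rigid_mild_mixing => // f cf ncf rigf.
by apply: norigid; exists f.
Qed.
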